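(* Suppose $u\in \mathcal{D}^{1,p}(\mathbb{R}^n)$ is an extremal whose $1-n/p$ Hölder ratio attains its maximum at two distinct points $x_0,y_0\in \mathbb{R}^n$, i.e. $[u]_{C^{1-n/p}(\mathbb{R}^n)}=\frac{|u(x_0)-u(y_0)|}{|x_0-y_0|^{1-n/p}}$. Then for each $\phi \in \mathcal{D}^{1,p}(\mathbb{R}^n)$ $$C^p_*\int_{\mathbb{R}^n}|Du|^{p-2}Du\cdot D\phi\, dx=\frac{|u(x_0)-u(y_0)|^{p-2}(u(x_0)-u(y_0))}{|x_0-y_0|^{p-n}}(\phi(x_0)-\phi(y_0)).$$
   Context: Throughout, $n\ge 1$ is an integer and $n<p<\infty$. $\mathcal{D}^{1,p}(\mathbb{R}^n)$ is the space of $u\in L^1_{\mathrm{loc}}(\mathbb{R}^n)$ whose weak first-order partial derivatives all belong to $L^p(\mathbb{R}^n)$. Every such $u$ has a Hölder continuous representative and is always identified with it. Put $[u]_{C^{1-n/p}(\mathbb{R}^n)}:=\sup_{x\ne y}\frac{|u(x)-u(y)|}{|x-y|^{1-n/p}}$ and $\|Du\|_{L^p(\mathbb{R}^n)}:=\left(\int_{\mathbb{R}^n}|Du|^p\,dx\right)^{1/p}$. Morrey's inequality says there is a finite constant $C$ with $[u]_{C^{1-n/p}(\mathbb{R}^n)}\le C\|Du\|_{L^p(\mathbb{R}^n)}$ for all $u\in\mathcal{D}^{1,p}(\mathbb{R}^n)$; $C_*$ denotes the sharp (smallest) such constant. An extremal is a function $u\in\mathcal{D}^{1,p}(\mathbb{R}^n)$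 with $[u]_{C^{1-n/p}(\mathbb{R}^n)}=C_*\|Du\|_{L^p(\mathbb{R}^n)}$. The expression $|z|^{p-2}z$ is understood to be $0$ when $z=0$. *)

(* Defs.v *)
From HB Require Import structures.
From mathcomp Require Import all_boot all_order all_algebra.
From mathcomp Require Import all_classical all_reals all_analysis.

Set Implicit Arguments.
Unset Strict Implicit.
Unset Printing Implicit Defensive.

Import Order.TTheory GRing.Theory Num.Theory.
Import numFieldNormedType.Exports.

Local Open Scope classical_set_scope.
Local Open Scope ring_scope.

(* Euclidean structure. The library norm `|x| on 'rV[R]_n is the sup norm; it
   induces the right topology but not the distances |x - y| and |Du|. *)

Definition edot (R : realType) (n : nat) (x y : 'rV[R]_n) : R :=
  \sum_(i < n) x 0 i * y 0 i.

Definition enorm (R : realType) (n : nat) (x : 'rV[R]_n) : R :=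
  Num.sqrt (edot x x).

(* The sigma-algebra on R^n is generated by the coordinate functions, i.e. it
   is the product Borel sigma-algebra. *)

Definition rV_display : measure_display -> measure_display.
Proof. exact. Qed.

Section measurable_rV.
Variables (R : realType) (n : nat).

Definition rV_coord (i : 'I_n) (x : 'rV[R]_n) : measurableTypeR R := x 0 i.

Let rV_set0 : g_sigma_preimage rV_coord set0.
Proof. exact: sigma_algebra0. Qed.

Let rV_setC A : g_sigma_preimage rV_coord A -> g_sigma_preimage rV_coord (~` A).
Proof. exact: sigma_algebraC. Qed.

Let rV_bigcup (F : (set 'rV[R]_n)^nat) :
  (forall i, g_sigma_preimage rV_coord (F i)) ->
  g_sigma_preimage rV_coord (\bigcup_i (F i)).
Proof. exact: sigma_algebra_bigcup. Qed.

HB.instance Definition _ := @isMeasurable.Build (rV_display (ocitv_display R))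
  'rV[R]_n (g_sigma_preimage rV_coord) rV_set0 rV_setC rV_bigcup.

End measurable_rV.

Section lebesgue_rV.
Variable R : realType.

Lemma measurable_fun_rVP d (T : measurableType d) n (f : T -> 'rV[R]_n) :
  (forall i, measurable_fun setT (fun x => f x 0 i : measurableTypeR R)) ->
  measurable_fun setT f.
Proof.
move=> mf; apply: (@measurability _ _ _ _ setT f
  (\big[setU/set0]_(i < n)
     preimage_set_system setT (@rV_coord R n i) measurable)) => //.
move=> _ [B + <-]; rewrite -bigcup_seq => -[i _ [A mA <-]].
by rewrite setTI; apply: mf.
Qed.

Lemma measurable_rV_coord n (i : 'I_n) :
  measurable_fun setT (@rV_coord R n i).
Proof.
move=> _ A mA; apply: sub_sigma_algebra; rewrite -bigcup_seq.
by exists i => /=; [rewrite mem_index_enum|exists A].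
Qed.

Definition rV_cons n (z : measurableTypeR R * 'rV[R]_n) : 'rV[R]_n.+1 :=
  row_mx (z.1 : R)%:M z.2.

Lemma measurable_rV_cons n : measurable_fun setT (@rV_cons n).
Proof.
apply: measurable_fun_rVP => i.
case: (split_ordP (i : 'I_(1 + n))) => j ->.
- rewrite [X in measurable_fun _ X](_ : _ = fst)//.
  apply/funext => z; apply: etrans (row_mxEl (z.1 : R)%:M z.2 0 j) _.
  by rewrite (ord1 j) mxE eqxx mulr1n.
- rewrite [X in measurable_fun _ X](_ : _ = @rV_coord R n j \o snd).
    by apply: measurableT_comp => //; exact: measurable_rV_coord.
  by apply/funext => z; exact: (row_mxEr (z.1 : R)%:M z.2 0 j).
Qed.

Definition rV_uncons n (x : 'rV[R]_n.+1) : measurableTypeR R * 'rV[R]_n :=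
  (lsubmx (x : 'rV_(1 + n)) 0 0, rsubmx (x : 'rV_(1 + n))).

Lemma measurable_rV_uncons n : measurable_fun setT (@rV_uncons n).
Proof.
apply: measurable_fun_pair => /=.
- rewrite [X in measurable_fun _ X](_ : _ = @rV_coord R n.+1 (lshift n (0 : 'I_1) : 'I_(1 + n))).
    exact: measurable_rV_coord.
  by apply/funext => x; rewrite mxE.
- apply: measurable_fun_rVP => i.
  rewrite [X in measurable_fun _ X](_ : _ = @rV_coord R n.+1 (rshift 1 i : 'I_(1 + n))).
    exact: measurable_rV_coord.
  by apply/funext => x; rewrite mxE.
Qed.

Lemma rV_consK n : cancel (@rV_cons n) (@rV_uncons n).
Proof.
move=> [a x]; rewrite /rV_uncons /rV_cons row_mxKl row_mxKr /= mxE eqxx.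
by rewrite mulr1n.
Qed.

Section lebesgue_step.
Variables (n : nat) (m : {sigma_finite_measure set 'rV[R]_n -> \bar R}).

(* Pushforward of the product measure along R x R^n ~ R^(n+1). *)
Definition lebesgue_step : set 'rV[R]_n.+1 -> \bar R :=
  pushforward (@lebesgue_measure R \x m)%E (@rV_cons n).

Let step0 : lebesgue_step set0 = 0%E.
Proof. by rewrite /lebesgue_step /pushforward preimage_set0 measure0. Qed.

Let step_ge0 A : (0 <= lebesgue_step A)%E.
Proof. by rewrite /lebesgue_step /pushforward; exact: integral_ge0. Qed.

Let step_sigma_additive : semi_sigma_additive lebesgue_step.
Proof.
have mc (A : set 'rV[R]_n.+1) : measurable A -> measurable (@rV_cons n @^-1` A).
  by move=> mA; rewrite -[X in measurable X]setTI; exact: measurable_rV_cons.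
move=> F mF tF mUF; rewrite /lebesgue_step /pushforward preimage_bigcup.
apply: measure_semi_sigma_additive.
- by move=> k; exact: mc.
- apply/trivIsetP => /= i j _ _ ij; rewrite -preimage_setI.
  by move/trivIsetP : tF => /(_ _ _ _ _ ij) ->//; rewrite preimage_set0.
- by rewrite -preimage_bigcup; exact: mc.
Qed.

HB.instance Definition _ := isMeasure.Build _ _ _ lebesgue_step
  step0 step_ge0 step_sigma_additive.

Let step_sigma_finite : sigma_finite setT lebesgue_step.
Proof.
have /sigma_finiteP[F [TF ndF Foo]] := sigma_finiteT (@lebesgue_measure R).
have /sigma_finiteP[G [TG ndG Goo]] := sigma_finiteT m.
exists (fun k => @rV_uncons n @^-1` (F k `*` G k)).
  rewrite -preimage_bigcup (_ : \bigcup_k (F k `*` G k) = setT) ?preimage_setT//.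
  rewrite -subTset => -[x y] _.
  have [k _ Fkx] : (\bigcup_k F k) x by rewrite -TF.
  have [l _ Gly] : (\bigcup_k G k) y by rewrite -TG.
  exists (maxn k l) => //; split => /=.
  - by move: x Fkx; exact/subsetPset/ndF/leq_maxl.
  - by move: y Gly; exact/subsetPset/ndG/leq_maxr.
move=> k; have [mF Fk] := Foo k; have [mG Gk] := Goo k; split.
  by rewrite -[X in measurable X]setTI; apply: measurable_rV_uncons => //;
    exact: measurableX.
rewrite /lebesgue_step /pushforward -comp_preimage.
rewrite (_ : _ \o _ = id); last by apply/funext => z; exact: rV_consK.
by rewrite preimage_id product_measure1E// lte_mul_pinfty// ge0_fin_numE.
Qed.

HB.instance Definition _ := Measure_isSigmaFinite.Build _ _ _ lebesgue_step
  step_sigma_finite.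

End lebesgue_step.

Fixpoint lebesgue_rV (n : nat) : {sigma_finite_measure set 'rV[R]_n -> \bar R} :=
  match n with
  | 0 => \d_(0 : 'rV[R]_0)
  | k.+1 => lebesgue_step (lebesgue_rV k)
  end.

Lemma lebesgue_rV_box n (A : 'I_n -> set (measurableTypeR R)) :
  (forall i, measurable (A i)) ->
  lebesgue_rV n [set x | forall i, A i (x 0 i)] =
  (\prod_(i < n) lebesgue_measure (A i))%E.
Proof.
elim: n A => [|n IHn] A mA /=.
  by rewrite big_ord0 diracE mem_set// => -[].
rewrite big_ord_recl -IHn; last by move=> i; exact: mA.
pose B := [set x : 'rV[R]_n | forall i, A (lift ord0 i) (x 0 i)].
rewrite /lebesgue_step /pushforward (_ : _ @^-1` _ = A ord0 `*` B); last first.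
  have c0 (z : measurableTypeR R * 'rV[R]_n) : rV_cons z 0 ord0 = z.1.
    rewrite (_ : ord0 = lshift n (0 : 'I_1)); last exact/val_inj.
    by apply: etrans (row_mxEl (z.1 : R)%:M z.2 0 0) _; rewrite mxE eqxx mulr1n.
  have cS (z : measurableTypeR R * 'rV[R]_n) i :
      rV_cons z 0 (lift ord0 i) = z.2 0 i.
    rewrite (_ : lift ord0 i = rshift 1 i); last exact/val_inj.
    exact: (row_mxEr (z.1 : R)%:M z.2 0 i).
  apply/seteqP; split=> [z /= Az|z [/= A0 Bz] i].
    by split=> [|i]; [rewrite -c0|rewrite -cS]; exact: Az.
  by case: (unliftP ord0 i) => [j|] ->; rewrite ?cS ?c0//; exact: Bz.
rewrite product_measure1E//.
rewrite (_ : B = \bigcap_(i in [set: 'I_n]) (@rV_coord R n i @^-1` A (lift ord0 i))).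
  apply: fin_bigcap_measurable => // i _.
  by rewrite -[X in measurable X]setTI; exact: measurable_rV_coord.
by apply/seteqP; split=> x Bx i; [move=> _; exact: Bx|exact: Bx].
Qed.

End lebesgue_rV.

Section sobolev.
Variables (R : realType) (n : nat).
Implicit Types (p : R) (u v f g phi : 'rV[R]_n -> R) (i : 'I_n).
Implicit Types (Du Dv : 'rV[R]_n -> 'rV[R]_n).

Local Notation leb := (@lebesgue_rV R n).

Definition partial i f : 'rV[R]_n -> R := 'D_(delta_mx 0 i) f.

Definition iter_partial (s : seq 'I_n) f : 'rV[R]_n -> R := foldr partial f s.

(* C^infinity: partial derivatives of all orders exist and are continuous. *)
Definition smooth f : Prop :=
  forall s : seq 'I_n, continuous (iter_partial s f) /\
    forall i x, derivable (iter_partial s f) x (delta_mx 0 i).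

Definition test_function f : Prop :=
  smooth f /\ compact (closure [set x | f x != 0]).

Definition loc_integrable f : Prop :=
  measurable_fun setT f /\
  forall K : set 'rV[R]_n, compact K -> (\int[leb]_(x in K) `|f x|%:E < +oo)%E.

(* Weak derivatives are only determined up to a null set, so the weak gradient
   is a relation: [weak_gradient u Du] says that the vector field Du is a
   version of it. *)
Definition weak_gradient u Du : Prop :=
  loc_integrable u /\
  forall i, loc_integrable (fun x => Du x 0 i) /\
    forall phi, test_function phi ->
      \int[leb]_x (u x * partial i phi x) = - \int[leb]_x (Du x 0 i * phi x).

(* u belongs to D^{1,p}(R^n) and Du is a version of its weak gradient. As
   elements of D^{1,p} are identified with their Hoelder continuous
   representatives, u itself is required to be continuous: an L^1_loc class has
   at most one continuous representative, so this selects the Hoelder one. *)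
Definition D1p p u Du : Prop :=
  [/\ continuous u, weak_gradient u Du &
      forall i, (fun x => Du x 0 i) \in Lfun leb p%:E].

Definition holder_ratio p u (x y : 'rV[R]_n) : R :=
  `|u x - u y| / enorm (x - y) `^ (1 - n%:R / p).

Definition holder_seminorm p u : \bar R :=
  ereal_sup [set h | exists x y, x != y /\ h = (holder_ratio p u x y)%:E].

Definition grad_norm p Du : \bar R :=
  ('N[leb]_p%:E [EFin \o (@enorm R n \o Du)])%E.

Definition morrey_bound p (C : R) : Prop :=
  forall u Du, D1p p u Du -> (holder_seminorm p u <= C%:E * grad_norm p Du)%E.

(* Morrey's inequality says that, for n >= 1 and n < p, the set below is nonempty;
   its infimum is then the smallest Morrey constant C_*. *)
Definition morrey_constant p : R := inf [set C | morrey_bound p C].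

Definition extremal p u Du : Prop :=
  D1p p u Du /\
  holder_seminorm p u = ((morrey_constant p)%:E * grad_norm p Du)%E.

End sobolev.

(* Main.v *)
(** Write [A = u x0 - u y0], [B = phi x0 - phi y0] and [d = enorm (x0 - y0)].
    Morrey's inequality with the sharp constant, applied to [u + t phi], says that
      [H t = C_*^p * \int |Du + t Dphi|^p - |A + t B|^p / d^(p - n)]
    is nonnegative, and [H 0 = 0] since [u] is an extremal whose Hoelder ratio is
    maximal at [x0, y0].  As [p > 1], [|a + t b|^p] is differentiable in [t], and its
    derivative is dominated for [|t| < 1] by the integrable [p (|Du| + |Dphi|)^p],
    so one may differentiate under the integral: [H' 0 = 0] is the theorem.  *)

Require Import Defs.
From HB Require Import structures.
From mathcomp Require Import all_boot all_order all_algebra.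
From mathcomp Require Import all_classical all_reals all_analysis.
From mathcomp Require Import measurable_realfun ring lra.

Set Implicit Arguments.
Unset Strict Implicit.
Unset Printing Implicit Defensive.

Import Order.TTheory GRing.Theory Num.Theory.
Import numFieldNormedType.Exports.

Local Open Scope classical_set_scope.
Local Open Scope ring_scope.

(** * Measurability on R^n, and linearity of weak gradients and of D^{1,p} *)

Section euclidean_measurability.
Context {R : realType} {n : nat}.
Implicit Types (f g psi : 'rV[R]_n -> R).

(** The sigma-algebra is generated by the coordinates, so boxes are measurable, and an open set is
    the union of the countably many rational boxes that it contains. *)
Lemma open_measurable_rV (U : set 'rV[R]_n) : open U -> measurable U.
Proof.
move=> oU.
pose box (q : 'rV[rat]_n) (r : rat) : set 'rV[R]_n :=
  \bigcap_(i in [set: 'I_n])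
    (rV_coord i @^-1` `]ratr (q 0 i) - ratr r, ratr (q 0 i) + ratr r[%classic).
have mbox q r : measurable (box q r).
  apply: fin_bigcap_measurable => // i _.
  by rewrite -[X in measurable X]setTI; exact: measurable_rV_coord.
pose F (z : 'rV[rat]_n * rat) : set 'rV[R]_n :=
  if `[< box z.1 z.2 `<=` U >] then box z.1 z.2 else set0.
suff -> : U = \bigcup_z F z.
  apply: countable_bigcupT_measurable => // z.
  by rewrite /F; case: ifP => _.
apply/seteqP; split => [x Ux|x [z _]]; last first.
  by rewrite /F; case: asboolP => // zU /zU.
have /nbhs_ballP[e /= e0 xeU] := open_nbhs_nbhs (conj oU Ux).
(* With [r < e / 2] and a centre within [r] of [x] in each coordinate, the box contains [x] and
   stays in the sup-norm ball of radius [e] about [x]. *)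
have [r] := rat_in_itvoo (divr_gt0 e0 (ltr0n R 2)).
rewrite in_itv/= => /andP[r0 re].
have /choice[q Hq] : forall i, exists q : rat,
    x 0 i - ratr r < ratr q < x 0 i + ratr r.
  move=> i; have [q] := @rat_in_itvoo R (x 0 i - ratr r) (x 0 i + ratr r)
    ltac:(lra).
  by rewrite in_itv/= => Hq; exists q.
exists (\row_i q i, r) => //.
have -> : F (\row_i q i, r) = box (\row_i q i) r.
  rewrite /F; case: asboolP => //= -[] y yq; apply: xeU.
  rewrite mx_norm_ball /ball_/= [`|_|]mx_normrE.
  apply/bigmax_ltP; split => // -[a i] _ /=.
  rewrite (ord1 a) !mxE ltr_norml.
  have := Hq i; have := yq i I; rewrite /rV_coord/= mxE in_itv/=.
  by move=> /andP[? ?] /andP[? ?]; apply/andP; split; lra.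
move=> i _; rewrite /rV_coord/= mxE in_itv/=.
by have /andP[? ?] := Hq i; apply/andP; split; lra.
Qed.

Lemma continuous_measurable_rV f : continuous f -> measurable_fun setT f.
Proof.
move=> /continuousP cf.
apply: (measurability _ (RGenOInfty.measurableE R)) => _ [_ [a ->] <-].
by rewrite setTI; apply: open_measurable_rV; exact: cf.
Qed.

Lemma compact_measurable_rV (K : set 'rV[R]_n) : compact K -> measurable K.
Proof.
move=> cK; rewrite -[K]setCK; apply: measurableC.
apply: open_measurable_rV; apply: closed_openC.
by apply: compact_closed cK; exact: norm_hausdorff.
Qed.

Lemma loc_integrable_lin f g (t : R) :
  loc_integrable f -> loc_integrable g ->
  loc_integrable (fun x => f x + t * g x).
Proof.
move=> [mf lf] [mg lg].
split=> [|K cK]; first by apply: measurable_funD => //; exact: measurable_funM.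
have mK := compact_measurable_rV cK.
have intK (h : 'rV[R]_n -> R) : measurable_fun setT h ->
    (\int[lebesgue_rV R n]_(x in K) `|h x|%:E < +oo)%E ->
    (lebesgue_rV R n).-integrable K (EFin \o h).
  move=> mh hK; apply/integrableP; split => //.
  by apply/measurable_EFinP/measurable_funTS.
have /integrableP[_] : (lebesgue_rV R n).-integrable K
    (EFin \o (fun x => f x + t * g x)) => //.
exact: (integrableD mK (intK _ mf (lf _ cK))
  (integrableZl mK t (intK _ mg (lg _ cK)))).
Qed.

(** A continuous [psi] is bounded on [K], [f] is integrable there, and the product vanishes off [K].
    It serves for test functions and for their partial derivatives. *)
Lemma loc_integrableM_compact f psi (K : set 'rV[R]_n) :
  loc_integrable f -> continuous psi -> compact K ->
  (forall x, ~ K x -> psi x = 0) ->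
  (lebesgue_rV R n).-integrable setT (fun x => (f x * psi x)%:E).
Proof.
move=> [mf lf] cpsi cK psiK.
have mpsi := continuous_measurable_rV cpsi.
have mK := compact_measurable_rV cK.
have -> : (fun x => (f x * psi x)%:E) =
    ((fun x => (f x * psi x)%:E) \_ K)%E.
  apply/funext => x; rewrite patchE; case: ifPn => // /negP xK.
  by rewrite psiK ?mulr0// => Kx; apply: xK; rewrite inE.
apply/(integrable_mkcond _ mK).
under eq_fun do rewrite EFinM.
apply: integrableMl => //.
- by apply/integrableP; split;
    [exact/measurable_EFinP/measurable_funTS|exact: lf].
- exact: measurable_funTS.
- have /compact_bounded[M [Mr psiM]] : compact (psi @` K).
    by apply: continuous_compact => //; exact: continuous_subspaceT.
  by exists M; split => // N MN x /= Kx; apply: psiM => //; exists x.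
Qed.

(** Off the closed support, [psi] is zero on a whole neighbourhood. Hence a partial derivative of a
    test function lives on the same compact set. *)
Lemma partial_eq0 (i : 'I_n) psi x :
  ~ closure [set y | psi y != 0] x -> partial i psi x = 0.
Proof.
move=> nx.
have nbx : \forall y \near x, psi y = 0.
  have := open_nbhs_nbhs (conj (closed_openC (@closed_closure _ _)) nx).
  apply: filterS => y /= ny; apply/eqP/negP => psiy.
  by apply: ny; apply: subset_closure; exact/negP.
rewrite /partial (near_eq_derive (delta_mx 0 i : 'rV[R]_n) nbx).
exact: derive_cst.
Qed.

Lemma test_function_integrable f psi : loc_integrable f -> test_function psi ->
  (lebesgue_rV R n).-integrable setT (fun x => (f x * psi x)%:E).
Proof.
move=> lf [spsi cpsi].
apply: (loc_integrableM_compact lf (spsi [::]).1 cpsi) => x nx.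
by apply/eqP/negP => /negP psix; apply: nx; exact: subset_closure.
Qed.

Lemma test_function_partial_integrable (i : 'I_n) f psi :
  loc_integrable f -> test_function psi ->
  (lebesgue_rV R n).-integrable setT (fun x => (f x * partial i psi x)%:E).
Proof.
move=> lf [spsi cpsi].
apply: (loc_integrableM_compact lf (spsi [:: i]).1 cpsi) => x.
exact: partial_eq0.
Qed.

(** The real-valued integral is additive on integrable functions only; the two preceding lemmas
    supply integrability for both sides of the weak gradient identity. *)
Lemma Rintegral_linM f g psi (t : R) :
  (lebesgue_rV R n).-integrable setT (fun x => (f x * psi x)%:E) ->
  (lebesgue_rV R n).-integrable setT (fun x => (g x * psi x)%:E) ->
  \int[lebesgue_rV R n]_x ((f x + t * g x) * psi x) =
  \int[lebesgue_rV R n]_x (f x * psi x) +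
  t * \int[lebesgue_rV R n]_x (g x * psi x).
Proof.
move=> If Ig.
under eq_Rintegral do rewrite mulrDl -mulrA.
rewrite RintegralD//; last exact: (integrableZl measurableT t Ig).
by rewrite RintegralZl.
Qed.

Lemma weak_gradient_lin f g Df Dg (t : R) :
  weak_gradient f Df -> weak_gradient g Dg ->
  weak_gradient (fun x => f x + t * g x) (fun x => Df x + t *: Dg x).
Proof.
move=> [lf wf] [lg wg]; split; first exact: loc_integrable_lin.
move=> i; have [lDf Df_f] := wf i; have [lDg Dg_g] := wg i.
have DE : (fun x => (Df x + t *: Dg x) 0 i) =
    (fun x => Df x 0 i + t * Dg x 0 i).
  by apply/funext => x; rewrite !mxE.
split=> [|psi tpsi]; first by rewrite DE; exact: loc_integrable_lin.
rewrite Rintegral_linM; [|exact: test_function_partial_integrable..].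
under [in RHS]eq_Rintegral do rewrite (congr1 (@^~ _) DE).
rewrite Rintegral_linM; [|exact: test_function_integrable..].
by rewrite Df_f// Dg_g// mulrN opprD.
Qed.

Lemma Lfun_coord_lin p (F G : 'rV[R]_n -> 'rV[R]_n) (t : R) (i : 'I_n) :
  1 <= p -> (fun x => F x 0 i) \in Lfun (lebesgue_rV R n) p%:E ->
  (fun x => G x 0 i) \in Lfun (lebesgue_rV R n) p%:E ->
  (fun x => (F x + t *: G x) 0 i) \in Lfun (lebesgue_rV R n) p%:E.
Proof.
move=> p1 LF LG.
have -> : (fun x => (F x + t *: G x) 0 i) =
    (fun x => F x 0 i) + (t \o* (fun x => G x 0 i)).
  by apply/funext => x; rewrite !mxE/= mulrC.
have p1E : (1 <= p%:E)%E by rewrite lee_fin.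
apply: (Lfun_addr_closed (lebesgue_rV R n) p1E).2 => //.
exact: Lfun_scale.
Qed.

(** This makes [u + t phi] a competitor in Morrey's inequality, with gradient [Du + t Dphi]. *)
Lemma D1p_lin p f g Df Dg (t : R) : 1 <= p ->
  D1p p f Df -> D1p p g Dg ->
  D1p p (fun x => f x + t * g x) (fun x => Df x + t *: Dg x).
Proof.
move=> p1 [cf wf lf] [cg wg lg]; split.
- by move=> x; apply: continuousD (cf x) _; exact: cvgMl_tmp (cg x).
- exact: weak_gradient_lin.
- by move=> i; exact: Lfun_coord_lin.
Qed.

End euclidean_measurability.

(** * Euclidean inner product and norm *)

Section edot_theory.
Context {R : realType} {n : nat}.
Implicit Types (x y : 'rV[R]_n).

Lemma edot_ge0 x : 0 <= edot x x.
Proof. by apply: sumr_ge0 => i _; rewrite -expr2 sqr_ge0. Qed.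

Lemma edotC x y : edot x y = edot y x.
Proof. by apply: eq_bigr => i _; rewrite mulrC. Qed.

Lemma edot_lin x y z (t : R) : edot (x + t *: y) z = edot x z + t * edot y z.
Proof.
rewrite /edot mulr_sumr -big_split; apply: eq_bigr => i _ /=.
by rewrite !mxE mulrDl mulrA.
Qed.

Lemma edot_line x y (t : R) :
  edot (x + t *: y) (x + t *: y) =
  edot x x + 2 * t * edot x y + t ^+ 2 * edot y y.
Proof.
rewrite edot_lin edotC edot_lin (edotC y (x + _)) edot_lin (edotC y x).
by ring.
Qed.

Lemma enorm_ge0 x : 0 <= enorm x.
Proof. exact: sqrtr_ge0. Qed.

Lemma sqr_enorm x : enorm x ^+ 2 = edot x x.
Proof. by rewrite sqr_sqrtr// edot_ge0. Qed.

Lemma enorm_gt0 x : x != 0 -> 0 < enorm x.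
Proof.
move=> x0; rewrite sqrtr_gt0 lt_neqAle edot_ge0 andbT eq_sym.
apply: contra x0; rewrite psumr_eq0 => [/allP H|i _]; last first.
  by rewrite -expr2 sqr_ge0.
apply/eqP/rowP => i; rewrite mxE.
by have := H i; rewrite mem_index_enum => /(_ isT); rewrite mulf_eq0 orbb => /eqP.
Qed.

Lemma edot_le x y : `|edot x y| <= enorm x * enorm y.
Proof.
have [->|y0] := eqVneq y 0.
  rewrite /edot big1 ?normr0 ?mulr_ge0 ?enorm_ge0// => i _.
  by rewrite mxE mulr0.
have yy : 0 < edot y y by rewrite -sqr_enorm exprn_gt0// enorm_gt0.
rewrite -ler_sqr ?nnegrE ?mulr_ge0 ?enorm_ge0// exprMn !sqr_enorm.
rewrite -normrX ger0_norm ?sqr_ge0//.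
(* Cauchy-Schwarz: subtracting from [x] its orthogonal projection on [y] leaves a vector of squared
   norm [a - b ^+ 2 / c], which is nonnegative. *)
have := edot_ge0 (x + (- (edot x y / edot y y)) *: y); rewrite edot_line.
set a := edot x x; set b := edot x y; set c := edot y y in yy *.
have -> : a + 2 * - (b / c) * b + (- (b / c)) ^+ 2 * c = a - b ^+ 2 / c.
  by field; rewrite gt_eqF.
by rewrite subr_ge0 ler_pdivrMr.
Qed.

Lemma enormD_scale x y (t : R) : enorm (x + t *: y) <= enorm x + `|t| * enorm y.
Proof.
rewrite -ler_sqr ?nnegrE ?addr_ge0 ?mulr_ge0 ?enorm_ge0//.
rewrite sqr_enorm edot_line sqrrD exprMn real_normK ?num_real// !sqr_enorm.
rewrite lerD2r lerD2l -[leRHS]mulr_natl -!mulrA ler_pM2l//.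
apply: le_trans (ler_norm _) _; rewrite normrM mulrCA.
by rewrite ler_wpM2l// edot_le.
Qed.

(** After squaring, each term is at most [|x_i|] times the whole sum. The bound transfers L^p
    membership from the coordinates to the Euclidean norm. *)
Lemma enorm_le_sum x : enorm x <= \sum_(i < n) `|x 0 i|.
Proof.
rewrite -ler_sqr ?nnegrE ?enorm_ge0 ?sumr_ge0// sqr_enorm expr2 mulr_suml.
apply: ler_sum => i _; apply: le_trans (ler_norm _) _; rewrite normrM.
rewrite ler_wpM2l// (bigD1 i)//= lerDl.
by apply: sumr_ge0.
Qed.

(** As a power of the quadratic form, [|x + t y|^p] can be differentiated in [t] even where the
    vector vanishes. *)
Lemma enorm_powR x (q : R) : enorm x `^ q = edot x x `^ (q / 2).
Proof. by rewrite /enorm -powR12_sqrt ?edot_ge0// -powRrM mulrC. Qed.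
End edot_theory.

(** * Derivative of a power of a nonnegative quadratic *)

Section powR_quadratic.
Context {R : realType}.

(* At a zero [s] of the nonnegative quadratic [g], [g t = c (t - s) ^ 2] and
   [g `^ q] is [o(t - s)] because [2 q > 1]. *)
Lemma is_derive_powR_quadratic (a b c q s : R) : 1 < 2 * q ->
  (forall t, 0 <= a + 2 * t * b + t ^+ 2 * c) ->
  is_derive s 1 (fun t : R => (a + 2 * t * b + t ^+ 2 * c) `^ q)
    (2 * q * ((a + 2 * s * b + s ^+ 2 * c) `^ (q - 1) * (b + s * c))).
Proof.
move=> q1 g_ge0; set g := fun t => a + 2 * t * b + t ^+ 2 * c.
have dg : is_derive s 1 g (2 * (b + s * c)).
  apply: is_derive_eq.
  (* Where [g s > 0] the chain rule applies; the rest of the proof treats a zero of [g]. *)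
  rewrite /GRing.scale/=; ring.
have [gs0|gs0] := eqVneq (g s) 0; last first.
  have gs : 0 < g s by rewrite lt_neqAle eq_sym gs0 g_ge0.
  have := @is_derive1_comp R (fun x : R => x `^ q) g s _ _ (is_derive1_powR q gs) dg.
  move=> /is_derive_eq; apply; rewrite -/(g s); ring.
have gE h : g (h + s) = 2 * h * (b + s * c) + h ^+ 2 * c.
  by rewrite -[RHS]addr0 -gs0 /g; ring.
(* The values of [g] at [s + 1] and [s - 1] add up to [2 c]. *)
have c_ge0 : 0 <= c.
  have := addr_ge0 (g_ge0 (1 + s)) (g_ge0 (-1 + s)); rewrite -!/(g _) !gE; nra.
(* A zero of [g] is a minimum, so the linear term [m] vanishes: at the increment [- m / (c + 1)],
   [g] would otherwise be negative. The denominator [c + 1] also covers [c = 0]. *)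
have bsc : b + s * c = 0.
  set m := b + s * c.
  have := g_ge0 (- (m / (c + 1)) + s); rewrite -/(g _) gE -/m.
  have -> : 2 * - (m / (c + 1)) * m + (- (m / (c + 1))) ^+ 2 * c =
      - (m ^+ 2 * (c + 2) / (c + 1) ^+ 2).
    by field; rewrite gt_eqF// ltr_wpDl.
  rewrite oppr_ge0 pmulr_lle0 ?invr_gt0 ?exprn_gt0 ?ltr_wpDl//.
  rewrite pmulr_lle0 ?ltr_wpDl// => m0.
  by apply/eqP; rewrite -sqrf_eq0 eq_le m0 sqr_ge0.
have qgt0 : 0 < q by lra.
rewrite bsc !mulr0.
suff H : h^-1 *: (g (h *: 1 + s) `^ q - g s `^ q) @[h --> 0^'] --> 0.
  by apply: DeriveDef; [exact: cvgP H|exact: cvg_lim H].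
rewrite gs0 powR0 ?gt_eqF//; apply: norm_cvg0.
(* This is the absolute value of the difference quotient; it tends to 0 because [2 q - 1 > 0]. *)
have E : (fun h : R => c `^ q * `|h| `^ (2 * q - 1)) @ 0^' --> 0.
  rewrite -[X in _ --> X](mulr0 (c `^ q)); apply: cvgM; first exact: cvg_cst.
  apply: (@cvg_comp _ _ _ (fun h : R => `|h|) (fun x : R => x `^ (2 * q - 1)) _ (0^'+)).
    move=> A [e /= e0 eA]; exists e => // h /=; rewrite sub0r normrN => he h0.
    by apply: eA; rewrite /= ?sub0r ?normrN ?normr_id// normr_gt0.
  by apply: powR_cvg0; lra.
apply: cvg_trans E; apply: near_eq_cvg; near=> h.
have h0 : h != 0 by near: h; exact: nbhs_dnbhs_neq.
rewrite subr0 [_%:A]mulr1 gE bsc mulr0 add0r normrZ normfV.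
rewrite (ger0_norm (powR_ge0 _ _)) powRM ?sqr_ge0//.
rewrite -[h ^+ 2]real_normK ?num_real// -powR_mulrn// -powRrM.
rewrite powRB ?powRr1// ?normr_eq0 ?h0 ?implybT//.
by ring.
Unshelve. all: by end_near. Qed.
End powR_quadratic.

(** * Domination in L^r, and the first-order condition at a minimum *)

Lemma Lfun_le d (T : measurableType d) (R : realType)
    (mu : {measure set T -> \bar R}) (r : R) (f g : T -> R) :
  0 <= r -> measurable_fun setT f -> g \in Lfun mu r%:E ->
  (forall x, `|f x| <= `|g x|) -> f \in Lfun mu r%:E.
Proof.
move=> r0 mf /andP[/[!inE]/= mg lg] fg; apply/andP; split; rewrite inE//=.
apply: le_lt_trans lg; rewrite unlock/=.
apply: gt0_ler_poweR; rewrite ?invr_ge0//.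
- by rewrite in_itv/= leey andbT; apply: integral_ge0.
- by rewrite in_itv/= leey andbT; apply: integral_ge0.
apply: ge0_le_integral => //=.
- apply/measurable_EFinP.
  by apply: (measurableT_comp (measurable_powR _)) => //; exact: measurableT_comp.
- apply/measurable_EFinP.
  by apply: (measurableT_comp (measurable_powR _)) => //; exact: measurableT_comp.
- by move=> x _; rewrite lee_fin ge0_ler_powR// nnegrE.
Qed.

(** If the derivative [b] were nonzero, [b] times the difference quotient would tend to [b ^ 2 > 0];
    at a minimum, increments of sign opposite to [b] make this product nonpositive. *)
Lemma is_derive_min_eq0 (R : realType) (f : R -> R) (c a : R) :
  is_derive c 1 f a -> (forall t, f c <= f t) -> a = 0.
Proof.
move=> [df <-] fmin; set b := 'D_1 f c; apply/eqP/negPn/negP => b0.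
have fb : h^-1 *: (f (h *: 1 + c) - f c) @[h --> 0^'] --> b by exact: df.
have : b * (h^-1 *: (f (h *: 1 + c) - f c)) @[h --> 0^'] --> b * b.
  exact: cvgMl_tmp.
have bb : 0 < b * b by rewrite -expr2 exprn_even_gt0.
move=> /cvgr_gt/(_ _ bb)[e /= e0 He].
(* The increment has sign opposite to [b], and size [e / 2] to stay in the punctured ball where the
   product is positive. *)
pose h := - (e / 2 * Num.sg b).
have sb : `|Num.sg b| = 1 by rewrite normr_sg b0.
have e20 : 0 < e / 2 by rewrite divr_gt0.
have h0 : h != 0 by rewrite oppr_eq0 mulf_neq0// ?sgr_eq0// gt_eqF.
have : `|0 - h| < e.
  by rewrite sub0r normrN normrN normrM sb mulr1 gtr0_norm// ltr_pdivrMr// mulr_natr mulr2n ltrDl.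
move=> /He/(_ h0); rewrite ltNge => /negP; apply.
rewrite /GRing.scale/= mulr1 mulrA; apply: mulr_le0_ge0; last by rewrite subr_ge0.
rewrite /h invrN mulrN oppr_le0 invfM mulrCA mulr_ge0 ?invr_ge0 ?(ltW e20)//.
by rewrite invr_sg mulrC -normrEsg.
Qed.

(** * The p-energy of the gradient and its derivative along a line *)

Section energy.
Context {R : realType} {n : nat} (p : R).
Local Notation leb := (lebesgue_rV R n).
Implicit Types (F G : 'rV[R]_n -> 'rV[R]_n).

Lemma measurable_edot F G :
  (forall i, measurable_fun setT (fun x => F x 0 i)) ->
  (forall i, measurable_fun setT (fun x => G x 0 i)) ->
  measurable_fun setT (fun x => edot (F x) (G x)).
Proof.
by move=> mF mG; apply: measurable_sum => i; exact: measurable_funM.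
Qed.

Lemma Lfun_measurable (f : 'rV[R]_n -> R) :
  f \in Lfun leb p%:E -> measurable_fun setT f.
Proof. by move=> /andP[/[!inE]]. Qed.

Lemma enorm_Lfun F : 1 < p ->
  (forall i, (fun x => F x 0 i) \in Lfun leb p%:E) ->
  @enorm R n \o F \in Lfun leb p%:E.
Proof.
move=> p1 LF; have p0 : 0 <= p by lra.
have p1E : (1 <= p%:E)%E by rewrite lee_fin ltW.
have mF i := Lfun_measurable (LF i).
have LS : (\sum_(i < n) (fun x => `|F x 0 i|)) \in Lfun leb p%:E.
  elim/big_ind : _ => [|f g|i _].
  - exact: (Lfun_addr_closed leb p1E).1.
  - exact: (Lfun_addr_closed leb p1E).2.
  - apply: Lfun_le (LF i) _ => //; first exact: measurableT_comp.
    by move=> x; rewrite normr_id.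
apply: Lfun_le LS _ => // [|x].
  rewrite (_ : _ \o _ = (fun x => edot (F x) (F x) `^ 2^-1)).
    by apply: (measurableT_comp (measurable_powR _)); exact: measurable_edot.
  by apply/funext => x; rewrite powR12_sqrt// edot_ge0.
rewrite /= (ger0_norm (enorm_ge0 _)) fct_sumE.
exact: le_trans (enorm_le_sum _) (ler_norm _).
Qed.

(** Finiteness of the L^p norm replaces the extended-real [grad_norm] by a real [N], whose p-th
    power is the energy to be differentiated. *)
Lemma grad_norm_fin F : 1 < p ->
  (forall i, (fun x => F x 0 i) \in Lfun leb p%:E) ->
  exists2 N : R, 0 <= N /\ grad_norm p F = N%:E &
    N `^ p = \int[leb]_x (enorm (F x) `^ p).
Proof.
move=> p1 LF; have p0 : p != 0 by rewrite gt_eqF//; lra.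
have /andP[_ /[!inE]/=] := enorm_Lfun p1 LF.
rewrite /finite_norm -/(grad_norm p F) => gfin.
have g0 : (0 <= grad_norm p F)%E by exact: Lnorm_ge0.
have gE : grad_norm p F = (fine (grad_norm p F))%:E by rewrite fineK// ge0_fin_numE.
exists (fine (grad_norm p F)); first by rewrite fine_ge0.
apply: EFin_inj; rewrite -poweR_EFin -gE /grad_norm powR_Lnorm//.
rewrite /Rintegral fineK; last first.
  have /integrable_fin_num := Lfun_integrable (ltW p1) (enorm_Lfun p1 LF).
  move=> /(_ measurableT); rewrite /=.
  by under eq_integral do rewrite (ger0_norm (enorm_ge0 _)).
by under eq_integral do rewrite /= (ger0_norm (enorm_ge0 _)).
Qed.

(** By Cauchy-Schwarz the left side is at most [|x|^(p - 1) |y|], and [p - 1 > 0] makes the power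
    monotone. When [x = 0] the inner product is 0, whatever value the power [p - 2] takes there. *)
Lemma energy_density_le (x y : 'rV[R]_n) (S : R) : 1 < p ->
  enorm x <= S -> enorm y <= S ->
  `|enorm x `^ (p - 2) * edot x y| <= S `^ p.
Proof.
move=> p1 xS yS; have S0 := le_trans (enorm_ge0 _) xS.
rewrite normrM (ger0_norm (powR_ge0 _ _)).
have [x0|x0] := eqVneq (enorm x) 0.
  have -> : `|edot x y| = 0.
    by apply/eqP; rewrite eq_le normr_ge0 andbT -(mul0r (enorm y)) -x0 edot_le.
  by rewrite mulr0 powR_ge0.
apply: le_trans (ler_wpM2l (powR_ge0 _ _) (edot_le x y)) _.
rewrite mulrA -[X in _ * X * _](powRr1 (enorm_ge0 x)) -powRD ?x0 ?implybT//.
have -> : S `^ p = S `^ (p - 2 + 1) * S.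
  rewrite -[X in _ * X](powRr1 S0) -powRD; first by congr (_ `^ _); ring.
  by rewrite (gt_eqF (lt_le_trans _ xS)) ?implybT// lt_neqAle eq_sym x0 enorm_ge0.
apply: ler_pM; rewrite ?powR_ge0 ?enorm_ge0//.
by rewrite ge0_ler_powR ?nnegrE ?enorm_ge0//; lra.
Qed.

Lemma is_derive_energy F G : 1 < p ->
  (forall i, (fun x => F x 0 i) \in Lfun leb p%:E) ->
  (forall i, (fun x => G x 0 i) \in Lfun leb p%:E) ->
  is_derive (0 : R) (1 : R)
    (fun t : R => \int[leb]_x (enorm (F x + t *: G x) `^ p))
    (p * \int[leb]_x (enorm (F x) `^ (p - 2) * edot (F x) (G x))).
Proof.
move=> p1 LF LG; have p0 : 0 < p by lra.
have LFG t : @enorm R n \o (fun x => F x + t *: G x) \in Lfun leb p%:E.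
  by apply: enorm_Lfun => // i; apply: Lfun_coord_lin; rewrite ?(ltW p1).
pose S x := enorm (F x) + enorm (G x).
have S_ge0 x : 0 <= S x by rewrite addr_ge0 ?enorm_ge0.
have intS : leb.-integrable setT (fun x => (S x `^ p)%:E).
  have p1E : (1 <= p%:E)%E by rewrite lee_fin ltW.
  have LS : (@enorm R n \o F) + (@enorm R n \o G) \in Lfun leb p%:E.
    by apply: (Lfun_addr_closed leb p1E).2; exact: enorm_Lfun.
  have := Lfun_integrable (ltW p1) LS.
  by under eq_fun do rewrite /= ger0_norm ?S_ge0//.
have df t x : is_derive t (1 : R) (fun t : R => enorm (F x + t *: G x) `^ p)
    (p * (enorm (F x + t *: G x) `^ (p - 2) * edot (F x + t *: G x) (G x))).
  have q1 : 1 < 2 * (p / 2) by lra.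
  have := is_derive_powR_quadratic t q1
    (* The nonnegativity of [|F x + s G x|^2] is transported along [edot_line] to its expansion as a
       quadratic in [s]. *)
    (fun s => eq_ind _ (fun z => 0 <= z) (edot_ge0 _) _ (edot_line (F x) (G x) s)).
  under eq_fun do rewrite -edot_line -enorm_powR.
  move=> /is_derive_eq; apply.
  rewrite -edot_line enorm_powR -edot_lin; by congr (_ * (_ `^ _ * _)); field.
(* On this window [|t| < 1], so [S] bounds [|F + t G|] independently of [t]. *)
pose I := `]-1, 1[%classic : set R.
have I0 : I 0 by rewrite /I/= in_itv/= ltrN10 ltr01.
have intf : forall t, I t -> leb.-integrable setT
    (EFin \o (fun x => enorm (F x + t *: G x) `^ p)).
  move=> t _; have := Lfun_integrable (ltW p1) (LFG t).
  by under eq_fun do rewrite /= ger0_norm ?enorm_ge0//.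
have dom : forall t x, I t ->
    `|enorm (F x + t *: G x) `^ (p - 2) * edot (F x + t *: G x) (G x)| <= S x `^ p.
  move=> t x; rewrite /I/= in_itv/= -ltr_norml => t1; apply: energy_density_le => //.
    apply: le_trans (enormD_scale _ _ _) _; rewrite lerD2l.
    by rewrite ler_piMl ?enorm_ge0// ltW.
  by rewrite lerDr enorm_ge0.
(* Integrability of the density at [t = 0] allows the factor [p] to be pulled out of the integral at
   the end. *)
have intdf : leb.-integrable setT
    (EFin \o (fun x => enorm (F x) `^ (p - 2) * edot (F x) (G x))).
  apply: le_integrable intS => // [|x _].
    apply/measurable_EFinP/measurable_funM.
      apply: (measurableT_comp (measurable_powR _)).
      by have := Lfun_measurable (enorm_Lfun p1 LF).
    by apply: measurable_edot => i; exact: Lfun_measurable.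
  rewrite lee_fin (ger0_norm (powR_ge0 _ _)).
  by have := dom 0 x I0; rewrite scale0r addr0.
have [ddf EdF] : derivable (fun t : R => \int[leb]_x (enorm (F x + t *: G x) `^ p))
      0 1 /\
    derive1 (fun t : R => \int[leb]_x (enorm (F x + t *: G x) `^ p)) 0 =
    \int[leb]_x (p * (enorm (F x) `^ (p - 2) * edot (F x) (G x))).
  have derf t x : I t -> setT x ->
      derivable (fun t : R => enorm (F x + t *: G x) `^ p) t 1.
    by move=> _ _; exact: (@ex_derive _ _ _ _ _ _ _ (df t x)).
  have intpS : leb.-integrable setT (EFin \o (fun x => p * S x `^ p)).
    exact: (integrableZl measurableT p intS).
  have pS_ge0 x : 0 <= p * S x `^ p by rewrite mulr_ge0 ?powR_ge0// ltW.
  have ub t x : I t -> setT x ->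
      `|partial1of2 (fun t x => enorm (F x + t *: G x) `^ p) t x| <= p * S x `^ p.
    move=> It _; rewrite partial1of2E (@derive_val _ _ _ _ _ _ _ (df t x)).
    by rewrite normrM (gtr0_norm p0) ler_pM2l// dom.
  split.
    exact: (derivable_under_integral measurableT I0 intf derf pS_ge0 intpS ub).
  rewrite (differentiation_under_integral measurableT I0 intf derf pS_ge0 intpS ub).
  apply: eq_Rintegral => x _; rewrite partial1of2E.
  by rewrite (@derive_val _ _ _ _ _ _ _ (df 0 x)) scale0r addr0.
by apply: DeriveDef => //; rewrite -derive1E EdF RintegralZl.
Qed.

End energy.

(** * Morrey's inequality with the sharp constant *)

Section morrey.
Context {R : realType} {n : nat} (p : R).

Lemma holder_ratio_le (u : 'rV[R]_n -> R) (x y : 'rV[R]_n) : x != y ->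
  ((holder_ratio p u x y)%:E <= holder_seminorm p u)%E.
Proof. by move=> xy; apply: ereal_sup_ubound; exists x, y. Qed.

(** The infimum of the admissible constants is itself admissible: for [N > 0] the ratio divided by
    [N] is a lower bound of these constants, and for [N = 0] any one of them already forces the
    ratio to be at most 0. *)
Lemma holder_ratio_le_morrey (v : 'rV[R]_n -> R) Dv (x y : 'rV[R]_n) (N : R) :
  has_inf [set C | morrey_bound n p C] -> D1p p v Dv -> x != y ->
  0 <= N -> grad_norm p Dv = N%:E ->
  holder_ratio p v x y <= morrey_constant n p * N.
Proof.
move=> [[C0 C0m] lbC] vD xy N0 NE.
have le C : morrey_bound n p C -> holder_ratio p v x y <= C * N.
  move=> Cm; rewrite -lee_fin [X in (_ <= X)%E]EFinM -NE.
  exact: le_trans (holder_ratio_le _ xy) (Cm _ _ vD).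
have [N00|Nneq0] := eqVneq N 0.
  by have := le _ C0m; rewrite N00 !mulr0.
have Ngt0 : 0 < N by rewrite lt_neqAle eq_sym Nneq0.
rewrite -ler_pdivrMr//; apply: lb_le_inf; first by exists C0.
by move=> C /le Cle; rewrite ler_pdivrMr.
Qed.
End morrey.

(** * The Euler-Lagrange identity for extremals *)

Theorem proposition2p3 (R : realType) (n : nat) (p : R)
  (n_ge1 : (1 <= n)%N) (n_lt_p : n%:R < p)
  (u : 'rV[R]_n -> R) (Du : 'rV[R]_n -> 'rV[R]_n)
  (u_extremal : extremal p u Du)
  (x0 y0 : 'rV[R]_n) (x0_neq_y0 : x0 != y0)
  (ratio_max : holder_seminorm p u =
     (`|u x0 - u y0| / enorm (x0 - y0) `^ (1 - n%:R / p))%:E)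
  (phi : 'rV[R]_n -> R) (Dphi : 'rV[R]_n -> 'rV[R]_n)
  (phi_D1p : D1p p phi Dphi) :
  morrey_constant n p `^ p *
    \int[lebesgue_rV R n]_x
      (enorm (Du x) `^ (p - 2) * edot (Du x) (Dphi x)) =
  `|u x0 - u y0| `^ (p - 2) * (u x0 - u y0) / enorm (x0 - y0) `^ (p - n%:R) *
    (phi x0 - phi y0).
Proof.
have p1 : 1 < p by apply: le_lt_trans n_lt_p; rewrite ler1n.
have [u_D1p u_eq] := u_extremal.
have [_ _ LDu] := u_D1p; have [_ _ LDphi] := phi_D1p.
set A := u x0 - u y0; set B := phi x0 - phi y0; set d := enorm (x0 - y0).
set C := morrey_constant n p.
have d0 : 0 < d by apply: enorm_gt0; rewrite subr_eq0.
have da0 r : 0 < d `^ r by exact: powR_gt0.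
have [N [N0 NE] NpE] := grad_norm_fin p1 LDu.
have AE : `|A| / d `^ (1 - n%:R / p) = C * N.
  by apply: EFin_inj; rewrite -ratio_max u_eq NE.
(* Without a Morrey bound, [inf] gives the junk value [C = 0], forcing [A = 0]. *)
have [infC|/inf_out C0] := pselect (has_inf [set c | morrey_bound n p c]); last first.
  have {}C0 : C = 0 := C0.
  have -> : A = 0.
    apply/eqP; rewrite -normr_eq0.
    by move/eqP : AE; rewrite C0 mul0r mulf_eq0 invr_eq0 (gt_eqF (da0 _)) orbF.
  by rewrite C0 powR0 ?gt_eqF ?mulr0 ?mul0r//; lra.
pose I t := \int[lebesgue_rV R n]_x (enorm (Du x + t *: Dphi x) `^ p).
have p0 : p != 0 by rewrite gt_eqF//; lra.
(* The exponents match since [(1 - n / p) p = p - n]. *)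
have ratioE (X : R) : 0 <= X ->
    X `^ p / d `^ (p - n%:R) = (X / d `^ (1 - n%:R / p)) `^ p.
  move=> X0; rewrite -!powRN powRM ?powR_ge0// -powRrM; congr (_ * _ `^ _).
  by field.
(* The sign of [C] is not known a priori, and [C `^ p = 1] for negative [C]. *)
have CME (M : R) : 0 <= M -> 0 <= C * M -> (C * M) `^ p = C `^ p * M `^ p.
  move=> M0 CM0; have [C0|C0] := leP 0 C; first exact: powRM.
  have -> : M = 0 by apply/eqP; rewrite eq_le M0 andbT -(nmulr_rge0 _ C0).
  by rewrite mulr0 powR0// mulr0.
(* Writing [|A + t B|^p] as [Q t] to the power [p / 2] lets the derivative lemma used for the energy
   apply here too, including when [A = 0]. *)
pose Q t := A ^+ 2 + 2 * t * (A * B) + t ^+ 2 * B ^+ 2.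
have QE t : Q t = (A + t * B) ^+ 2 by rewrite /Q; ring.
have normQ t : Q t `^ (p / 2) = `|A + t * B| `^ p.
  rewrite QE -real_normK ?num_real// -powR_mulrn// -powRrM.
  by congr (_ `^ _); field.
pose H t := C `^ p * I t - Q t `^ (p / 2) / d `^ (p - n%:R).
have H_ge0 t : 0 <= H t.
  have vD := D1p_lin t (ltW p1) u_D1p phi_D1p.
  have [M [M0 ME] MpE] := grad_norm_fin p1 (let: And3 _ _ L := vD in L).
  have := holder_ratio_le_morrey infC vD x0_neq_y0 M0 ME.
  rewrite /holder_ratio -/d -/C.
  have -> : u x0 + t * phi x0 - (u y0 + t * phi y0) = A + t * B.
    by rewrite /A /B; ring.
  move=> ABt; have r0 : 0 <= `|A + t * B| / d `^ (1 - n%:R / p).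
    by rewrite divr_ge0// powR_ge0.
  (* The Hölder ratio is nonnegative, which gives [C * M] the sign that [CME] requires. *)
  have CM0 := le_trans r0 ABt.
  rewrite subr_ge0 normQ /I -MpE -CME// ratioE// ge0_ler_powR ?nnegrE//.
  exact: ltW (lt_trans ltr01 p1).
have H0 : H 0 = 0.
  have I0E : I 0 = N `^ p.
    by rewrite NpE; apply: eq_Rintegral => x _; rewrite scale0r addr0.
  rewrite /H normQ I0E mul0r addr0 ratioE// AE CME ?subrr//.
  by rewrite -AE divr_ge0// powR_ge0.
pose c := `|A| `^ (p - 2) * (A * B).
have dQ : is_derive (0 : R) 1 (fun t => Q t `^ (p / 2)) (p * c).
  have q1 : 1 < 2 * (p / 2) by rewrite mulrC divfK.
  have Q_ge0 t : 0 <= A ^+ 2 + 2 * t * (A * B) + t ^+ 2 * B ^+ 2.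
    by rewrite -/(Q t) QE sqr_ge0.
  have := is_derive_powR_quadratic 0 q1 Q_ge0.
  move=> /is_derive_eq; apply; rewrite /c -/(Q 0) QE !mul0r !addr0.
  rewrite -real_normK ?num_real// -powR_mulrn// -powRrM.
  by congr (_ * (_ `^ _ * _)); field.
have dI := is_derive_energy p1 LDu LDphi.
have dH : is_derive (0 : R) 1 H
    (C `^ p * (p * \int[lebesgue_rV R n]_x
       (enorm (Du x) `^ (p - 2) * edot (Du x) (Dphi x))) -
     (d `^ (p - n%:R))^-1 * (p * c)).
  have := is_deriveB (is_deriveZ (C `^ p) dI) (is_deriveZ (d `^ (p - n%:R))^-1 dQ).
  rewrite (_ : _ - _ = H)//; apply/funext => t.
  by rewrite /H; congr (_ - _); exact: mulrC.
(* Since [H 0 = 0 <= H t], the point 0 is a global minimum of [H]; cancelling [p] in the vanishing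
   derivative leaves the identity. *)
have := is_derive_min_eq0 dH (fun t => eq_ind_r (fun z => z <= H t) (H_ge0 t) H0).
set J := \int[_]_x _ => /eqP.
rewrite mulrCA [_^-1 * _]mulrCA -mulrBr mulf_eq0 (negbTE p0)/= subr_eq0 => /eqP ->.
by rewrite /c; ring.
Qed.
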